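(* Let $n\ge 3$ and let $F_n^1$ be the complex $n$-dimensional Leibniz algebra with basis $\{x_1,\dots,x_n\}$ and multiplication $[x_i,x_1]=x_{i+1}$ for $2\le i\le n-1$ (all other products of basis elements are zero). Then every infinitesimal deformation $\varphi\in ZL^2(F_n^1,F_n^1)$ has the following form, for some complex numbers $\alpha_{j,k}$, $\gamma_1$, $\gamma_n$, $\beta_2,\dots,\beta_n$: $$\begin{cases}\varphi(x_1,x_1)=\sum_{k=2}^{n}\alpha_{1,k}x_k,\\ \varphi(x_j,x_1)=\sum_{k=1}^{n}\alpha_{j,k}x_k, & 2\le j\le n-1,\\ \varphi(x_n,x_1)=\sum_{k=2}^{n}\alpha_{n,k}x_k,\\ \varphi(x_1,x_2)=\gamma_1x_1+\gamma_nx_n,\\ \varphi(x_i,x_2)=((i-2)\gamma_1+\beta_2)x_i+\sum_{k=3}^{n+2-i}\beta_kx_{k+i-2}, & 2\le i\le n,\\ \varphi(x_i,x_3)=-(\alpha_{2,1}+\gamma_1)x_{i+1}, & 2\le i\le n-1,\\ \varphi(x_i,x_{j+1})=-\alpha_{j,1}x_{i+1}, & 2\le i\le n-1,\ 3\le j\le n-1,\end{cases}$$ where all values $\varphi(x_p,x_q)$ not listed are zero.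
   Context: A Leibniz algebra over $\mathbb{C}$ is a vector space $L$ with a bilinear bracket satisfying $[x,[y,z]]=[[x,y],z]-[[x,z],y]$ for all $x,y,z$. An infinitesimal deformation ($2$-cocycle) of $L$ is a bilinear map $\varphi:L\times L\to L$ with $$[x,\varphi(y,z)]-[\varphi(x,y),z]+[\varphi(x,z),y]+\varphi(x,[y,z])-\varphi([x,y],z)+\varphi([x,z],y)=0$$ for all $x,y,z\in L$; the space of all of them is denoted $ZL^2(L,L)$. *)

(* Defs.v *)
From HB Require Import structures.
From mathcomp Require Import all_boot all_order all_algebra.
From mathcomp Require Import reals complex.

Set Implicit Arguments.
Unset Strict Implicit.
Unset Printing Implicit Defensive.

Import GRing.Theory.
Local Open Scope ring_scope.

(* Right Leibniz algebras: all right multiplications are derivations. *)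
HB.mixin Record Lmodule_isLeibniz (K : fieldType) L of GRing.Lmodule K L := {
  bracket : {bilinear L -> L -> L};
  leibniz_identity : forall x y z : L,
    bracket x (bracket y z) = bracket (bracket x y) z - bracket (bracket x z) y
}.

#[short(type="leibnizAlgType")]
HB.structure Definition LeibnizAlgebra (K : fieldType) :=
  { L of GRing.Lmodule K L & Lmodule_isLeibniz K L }.

Definition ZL2 (K : fieldType) (L : leibnizAlgType K)
    (phi : {bilinear L -> L -> L}) : Prop :=
  forall x y z : L,
    bracket x (phi y z) - bracket (phi x y) z + bracket (phi x z) y
    + phi x (bracket y z) - phi (bracket x y) z + phi (bracket x z) y = 0.

Definition F1 (K : fieldType) (n : nat) : Type := 'rV[K]_n.

HB.instance Definition _ (K : fieldType) (n : nat) :=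
  GRing.Lmodule.on (F1 K n).

(* Basis vectors are numbered from 1: [F1_basis K n k] is x_k for
   1 <= k <= n, and 0 for every other k. *)
Definition F1_basis (K : fieldType) (n k : nat) : F1 K n :=
  \row_(j < n) (j.+1 == k)%:R.

Definition F1_table (K : fieldType) (n i j : nat) : F1 K n :=
  if (2 <= i <= n - 1)%N && (j == 1%N) then F1_basis K n i.+1 else 0.

Definition F1_bracket (K : fieldType) (n : nat) (u v : F1 K n) : F1 K n :=
  \sum_(i < n) \sum_(j < n) (u 0 i * v 0 j) *: F1_table K n i.+1 j.+1.

Section F1Theory.
Variables (K : fieldType) (n : nat).
Implicit Types u v w : F1 K n.

Lemma F1_basis_sum u : u = \sum_(i < n) u 0 i *: F1_basis K n i.+1.
Proof.
apply/rowP=> j; rewrite summxE (bigD1 j) //= big1 => [|i ne_ij].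
  by rewrite !mxE eqxx mulr1 addr0.
by rewrite !mxE eqSS eq_sym (negPf (ne_ij : (i : nat) != j)) mulr0.
Qed.

Lemma F1_bracket_basis i j : (1 <= i <= n)%N -> (1 <= j <= n)%N ->
  F1_bracket (F1_basis K n i) (F1_basis K n j) = F1_table K n i j.
Proof.
case: i => // i; case: j => // j /= lt_i lt_j.
rewrite /F1_bracket (bigD1 (Ordinal lt_i)) //= (bigD1 (Ordinal lt_j)) //=.
rewrite !mxE !eqxx mulr1 scale1r big1 => [|l ne_l]; last first.
  by rewrite !mxE !eqSS (negPf (ne_l : (l : nat) != j)) mulr0 scale0r.
rewrite big1 ?addr0 // => k ne_k; rewrite big1 // => l _.
by rewrite !mxE eqSS (negPf (ne_k : (k : nat) != i)) mul0r scale0r.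
Qed.

Let lead v : K := \sum_(j < n | j.+1 == 1%N) v 0 j.
Let shift u : F1 K n := \sum_(i < n) u 0 i *: F1_table K n i.+1 1.

Let F1_bracketE u v : F1_bracket u v = lead v *: shift u.
Proof.
rewrite /F1_bracket /shift scaler_sumr; apply: eq_bigr => i _.
rewrite /lead scaler_suml [RHS]big_mkcond /=; apply: eq_bigr => j _.
rewrite /F1_table; case: (j.+1 == 1%N); last by rewrite andbF scaler0.
by rewrite scalerA mulrC.
Qed.

Let lead_linear a u v : lead (a *: u + v) = a * lead u + lead v.
Proof.
rewrite /lead mulr_sumr -big_split /=.
by apply: eq_bigr => j _; rewrite !mxE.
Qed.

Let shift_linear a u v : shift (a *: u + v) = a *: shift u + shift v.
Proof.
rewrite /shift scaler_sumr -big_split /=.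
by apply: eq_bigr => i _; rewrite !mxE scalerDl scalerA.
Qed.

Fact F1_bracket_bilinear :
  bilinear_for *:%R *:%R (@F1_bracket K n).
Proof.
split=> [v a u w | u a v w]; rewrite !F1_bracketE.
  by rewrite shift_linear scalerDr scalerA [lead v * a]mulrC -scalerA.
by rewrite lead_linear scalerDl -scalerA.
Qed.

HB.instance Definition _ :=
  bilinear_isBilinear.Build K (F1 K n) (F1 K n) (F1 K n) *:%R *:%R
    (@F1_bracket K n) F1_bracket_bilinear.

Let lead_shift u : lead (shift u) = 0.
Proof.
rewrite /lead big1 // => j /eqP[j0]; rewrite summxE big1 // => i _.
rewrite mxE /F1_table; case: ifP => _; last by rewrite mxE mulr0.
by rewrite mxE j0 mulr0.
Qed.

Fact F1_leibniz u v w :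
  F1_bracket u (F1_bracket v w) =
  F1_bracket (F1_bracket u v) w - F1_bracket (F1_bracket u w) v.
Proof.
have shiftZ a x : shift (a *: x) = a *: shift x.
  rewrite /shift scaler_sumr.
  by apply: eq_bigr => i _; rewrite !mxE scalerA.
have leadZ a x : lead (a *: x) = a * lead x.
  by rewrite /lead mulr_sumr; apply: eq_bigr => j _; rewrite !mxE.
rewrite !F1_bracketE leadZ lead_shift mulr0 scale0r !shiftZ !scalerA.
by rewrite mulrC subrr.
Qed.

HB.instance Definition _ := Lmodule_isLeibniz.Build K (F1 K n) F1_leibniz.

Lemma bracket_F1_basis i j : (1 <= i <= n)%N -> (1 <= j <= n)%N ->
  bracket (F1_basis K n i) (F1_basis K n j) = F1_table K n i j.
Proof. exact: F1_bracket_basis. Qed.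

End F1Theory.

(* Main.v *)
Require Import Defs.
From HB Require Import structures.
From mathcomp Require Import all_boot all_order all_algebra.
From mathcomp Require Import reals complex.

Import GRing.Theory.
Local Open Scope ring_scope.

(** Write e(v) for the coordinate of v on x_1 and S for the nilpotent shift
    x_i |-> x_(i+1) (2 <= i < n), x_1, x_n |-> 0. The bracket of F_n^1 is
    [u, v] = e(v) S u ([bracket_coord1], [bracket_basis_x1]), so the cocycle
    identity at (u, y, z) reads
      e(phi(y, z)) S u - e(z) S phi(u, y) + e(y) S phi(u, z)
      + e(z) phi(u, S y) - e(y) phi(S u, z) + e(z) phi(S u, y) = 0.
    For y, z among the basis vectors this gives:
    - y, z among x_2, ..., x_n: e(phi(y, z)) S u = 0, so e(phi(y, z)) = 0, as
      S x_2 = x_3 is nonzero ([cocycle_coord1_basis]);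
    - y = z = x_1: e(phi(x_1, x_1)) = 0 ([cocycle_coord1_x1_x1]);
    - y = x_1, z = x_j with j >= 2: phi(S u, x_j) = S phi(u, x_j)
      + e(phi(x_1, x_j)) S u ([cocycle_shift_l]);
    - y = x_j, z = x_1, combined with the previous line: phi(u, S x_j) =
      - (e(phi(x_j, x_1)) + e(phi(x_1, x_j))) S u ([cocycle_shift_r]).

    The last rule determines every column q >= 3 of phi, since x_q = S x_(q-1);
    taking u = x_1 there shows phi(x_1, x_q) = 0, so for q >= 4 only the term
    - e(phi(x_(q-1), x_1)) remains, while q = 3 keeps gamma_1 =
    e(phi(x_1, x_2)). At j = n, where S x_n = 0, the same rule forces
    e(phi(x_n, x_1)) = 0. The column q = 2 comes from the left rule: with
    u = x_1 it puts phi(x_1, x_2) in ker S, which is spanned by x_1 and x_n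
    ([bracket_x1_eq0]), and with u = x_i it computes phi(x_i, x_2) by induction
    from phi(x_2, x_2) = sum_k beta_k x_k, each step shifting the value and
    adding gamma_1 x_(i+1). The column q = 1 is otherwise unconstrained. *)

(** * The algebra as a shift operator *)

Section ShiftStructure.
Context {K : fieldType} {n : nat}.
Implicit Types u v w : F1 K n.

Local Notation x k := (F1_basis K n k).

(** A sum of at most one term rather than an entry, so that k can range over
    all of nat, as it does for the basis vectors. *)
Definition F1_coord u (k : nat) : K := \sum_(j < n | j.+1 == k) u 0 j.

Lemma F1_coord_linear k a u v :
  F1_coord (a *: u + v) k = a * F1_coord u k + F1_coord v k.
Proof.
rewrite /F1_coord mulr_sumr -big_split /=.
by apply: eq_bigr => j _; rewrite !mxE.
Qed.

Lemma F1_coord0 k : F1_coord 0 k = 0.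
Proof. by rewrite /F1_coord big1 // => j _; rewrite mxE. Qed.

Lemma F1_coordD u v k : F1_coord (u + v) k = F1_coord u k + F1_coord v k.
Proof. by have := F1_coord_linear k 1 u v; rewrite scale1r mul1r. Qed.

Lemma F1_coordZ a u k : F1_coord (a *: u) k = a * F1_coord u k.
Proof. by rewrite -[a *: u]addr0 F1_coord_linear F1_coord0 addr0. Qed.

Lemma F1_coord_sum (I : Type) (r : seq I) (P : pred I) (E : I -> F1 K n) k :
  F1_coord (\sum_(i <- r | P i) E i) k = \sum_(i <- r | P i) F1_coord (E i) k.
Proof.
exact: (big_morph (F1_coord^~ k) (fun u v => F1_coordD u v k) (F1_coord0 k)).
Qed.

Lemma F1_coord_basis i k : (1 <= i <= n)%N -> F1_coord (x i) k = (i == k)%:R.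
Proof.
case: i => // i /= lt_i.
rewrite /F1_coord big_mkcond (bigD1 (Ordinal lt_i)) //=.
rewrite mxE eqxx big1 ?addr0 => [|j ne_j]; first by case: (_ == k).
by rewrite mxE eqSS (negPf (ne_j : (j : nat) != i)) if_same.
Qed.

Lemma F1_basis_out {k} : (n < k)%N -> x k = 0.
Proof.
move=> lt_nk; apply/rowP=> j; rewrite !mxE.
by rewrite ltn_eqF // (leq_ltn_trans (ltn_ord j)).
Qed.

Lemma F1_coord_expand u : u = \sum_(1 <= k < n.+1) F1_coord u k *: x k.
Proof.
rewrite big_add1 big_mkord [LHS]F1_basis_sum; apply: eq_bigr => j _.
by rewrite /F1_coord (big_pred1 j) // => i; rewrite /= eqSS.
Qed.

Lemma F1_coord1_eq0_expand u :
  F1_coord u 1 = 0 -> u = \sum_(2 <= k < n.+1) F1_coord u k *: x k.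
Proof.
move=> u1; rewrite [LHS]F1_coord_expand.
case: (posnP n) => [n0 | n_gt0]; first by rewrite !big_geq // n0.
by rewrite big_ltn // u1 scale0r add0r.
Qed.

Lemma bracket_x1_x1 : bracket (x 1) (x 1) = 0.
Proof.
case: (posnP n) => [n0 | n_gt0]; first by rewrite F1_basis_out ?n0 ?linear0r.
by rewrite bracket_F1_basis.
Qed.

(** This holds for every i >= 2: at i = n the right side is the vanishing
    vector x_(n+1), so no end point needs separate treatment. *)
Lemma bracket_basis_x1 {i} : (2 <= i)%N -> bracket (x i) (x 1) = x i.+1.
Proof.
move=> i_ge2; case: (leqP i n) => [le_in | lt_ni]; last first.
  by rewrite (F1_basis_out lt_ni) (F1_basis_out (leqW lt_ni)) linear0l.
have n_gt0 : (0 < n)%N by apply: leq_trans le_in; apply: ltnW.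
rewrite bracket_F1_basis ?(ltnW i_ge2) //.
rewrite /F1_table i_ge2 andbT /= subn1.
case: leqP => // ?; rewrite F1_basis_out // ltnS.
by rewrite -(prednK n_gt0).
Qed.

(** Right multiplication by any vector is a multiple of the nilpotent shift
    u |-> [u, x_1], since only x_1 multiplies nontrivially on the right. *)
Lemma bracket_coord1 u v : bracket u v = F1_coord v 1 *: bracket u (x 1).
Proof.
have ann k : (2 <= k <= n)%N -> bracket u (x k) = 0.
  move=> /andP[k_ge2 le_kn].
  rewrite [u]F1_coord_expand linear_sumlz big_nat big1 // => i.
  move=> /andP[i_ge1 i_le].
  rewrite linearZl_LR /= bracket_F1_basis ?i_ge1 ?(ltnW k_ge2) //.
  by rewrite /F1_table [k == _]gtn_eqF // andbF scaler0.
case: (posnP n) => [n0 | n_gt0].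
  have ->: v = 0 by rewrite [v]F1_coord_expand big_geq // n0.
  by rewrite linear0r F1_coord0 scale0r.
rewrite [in LHS](F1_coord_expand v) linear_sumr big_ltn // linearZr_LR /=.
rewrite big_nat big1 ?addr0 // => k k_int.
by rewrite linearZr_LR /= ann ?scaler0.
Qed.

(** The shift sends x_2, ..., x_(n-1) to distinct basis vectors and kills only
    x_1 and x_n among the basis. *)
Lemma bracket_x1_eq0 u : (2 <= n)%N -> bracket u (x 1) = 0 ->
  u = F1_coord u 1 *: x 1 + F1_coord u n *: x n.
Proof.
move=> n_ge2 u_x1.
have mid k : (2 <= k < n)%N -> F1_coord u k = 0.
  move=> /andP[k_ge2 lt_kn].
  transitivity (F1_coord (bracket u (x 1)) k.+1); last first.
    by rewrite u_x1 F1_coord0.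
  rewrite [in RHS](F1_coord_expand u) linear_sumlz F1_coord_sum.
  rewrite (bigD1_seq k) ?iota_uniq //=; last first.
    by rewrite mem_index_iota (ltnW k_ge2) ltnS ltnW.
  rewrite linearZl_LR F1_coordZ bracket_basis_x1 // F1_coord_basis //.
  rewrite eqxx mulr1 big1_seq ?addr0 // => i /andP[ne_ik].
  rewrite mem_index_iota => /andP[i_ge1 lt_i]; rewrite linearZl_LR F1_coordZ.
  case: (eqVneq i 1%N) => [->|ne_i1].
    by rewrite bracket_x1_x1 F1_coord0 mulr0.
  have i_ge2 : (2 <= i)%N by rewrite ltn_neqAle eq_sym ne_i1.
  rewrite bracket_basis_x1 //; case: (leqP i.+1 n) => [lt_in | ?].
    by rewrite F1_coord_basis // eqSS (negPf ne_ik) mulr0.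
  by rewrite F1_basis_out // F1_coord0 mulr0.
rewrite {1}[u]F1_coord_expand big_ltn ?ltnS ?(ltnW n_ge2) // big_nat_recr //=.
by rewrite big_nat big1 ?add0r // => k k_mid; rewrite mid // scale0r.
Qed.

End ShiftStructure.

(** * Consequences of the cocycle identity *)

Section Cocycle.
Context {K : fieldType} {n : nat}.
Variable phi : {bilinear F1 K n -> F1 K n -> F1 K n}.
Hypotheses (n_ge3 : (3 <= n)%N) (phi_cocycle : ZL2 phi).

Local Notation x k := (F1_basis K n k).
Local Notation c := F1_coord.

Let coord1_basis i : (2 <= i)%N -> c (x i) 1 = 0.
Proof.
move=> i_ge2; case: (leqP i n) => [le_in | lt_ni].
  by rewrite F1_coord_basis ?(ltnW i_ge2) // gtn_eqF.
by rewrite F1_basis_out ?F1_coord0.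
Qed.

(** This is where 3 <= n enters: x_3 = [x_2, x_1] is nonzero, so evaluating an
    identity between multiples of the shift at x_2 compares the scalars. *)
Let bracket_x2_neq0 a : a *: bracket (x 2) (x 1) = 0 -> a = 0.
Proof.
rewrite bracket_basis_x1 // => a_x3.
have: c (a *: x 3) 3 = 0 by rewrite a_x3 F1_coord0.
by rewrite F1_coordZ F1_coord_basis // eqxx mulr1.
Qed.

(** The cocycle identity at (x_2, x_i, x_j): the brackets with x_i and x_j all
    vanish, leaving only [x_2, phi (x_i, x_j)]. *)
Lemma cocycle_coord1_basis i j : (2 <= i)%N -> (2 <= j)%N ->
  c (phi (x i) (x j)) 1 = 0.
Proof.
move=> i_ge2 j_ge2; apply: bracket_x2_neq0; rewrite -bracket_coord1.
have := phi_cocycle (x 2) (x i) (x j).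
have ann u k : (2 <= k)%N -> bracket u (x k) = 0.
  by move=> k_ge2; rewrite bracket_coord1 coord1_basis // scale0r.
by rewrite !ann // !linear0l linear0r !subr0 !addr0.
Qed.

(** At (x_2, x_1, x_1) all terms but [x_2, phi (x_1, x_1)] cancel in pairs or
    contain [x_1, x_1] = 0. *)
Lemma cocycle_coord1_x1_x1 : c (phi (x 1) (x 1)) 1 = 0.
Proof.
apply: bracket_x2_neq0; rewrite -bracket_coord1.
have := phi_cocycle (x 2) (x 1) (x 1).
by rewrite bracket_x1_x1 linear0r addr0 !subrK.
Qed.

(** At (u, x_1, x_j): the failure of phi (-, x_j) to commute with the shift is
    a scalar multiple of the shift, the scalar being independent of u. *)
Lemma cocycle_shift_l u j : (2 <= j)%N ->
  phi (bracket u (x 1)) (x j) =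
  bracket (phi u (x j)) (x 1) + c (phi (x 1) (x j)) 1 *: bracket u (x 1).
Proof.
move=> j_ge2; have := phi_cocycle u (x 1) (x j).
rewrite [bracket u (phi _ _)]bracket_coord1.
rewrite ![bracket _ (x j)]bracket_coord1 coord1_basis // !scale0r.
rewrite linear0r linear0l subr0 !addr0 => /eqP.
by rewrite subr_eq0 addrC => /eqP <-.
Qed.

(** Adding the identities at (u, x_1, x_j) and (u, x_j, x_1) cancels the terms
    phi ([u, x_1], x_j) and [phi (u, x_j), x_1], so moving the shift to the
    right argument of phi leaves a multiple of the shift of u. *)
Lemma cocycle_shift_r u j : (2 <= j)%N ->
  phi u (bracket (x j) (x 1)) =
  - (c (phi (x j) (x 1)) 1 + c (phi (x 1) (x j)) 1) *: bracket u (x 1).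
Proof.
move=> j_ge2; have := phi_cocycle u (x j) (x 1).
rewrite [bracket u (phi _ _)]bracket_coord1 cocycle_shift_l //.
rewrite [bracket u (x j)]bracket_coord1 [bracket (phi u _) (x j)]bracket_coord1.
rewrite coord1_basis // !scale0r linear0l subr0 addr0.
rewrite [_ + phi u _]addrAC addrA subrK addrAC -scalerDl addrC => /eqP.
by rewrite addr_eq0 -scaleNr => /eqP.
Qed.

Lemma cocycle_x1_basis_eq0 j : (3 <= j)%N -> phi (x 1) (x j) = 0.
Proof.
case: j => // j; rewrite ltnS => j_ge2.
by rewrite -(bracket_basis_x1 j_ge2) cocycle_shift_r // bracket_x1_x1 scaler0.
Qed.

Lemma cocycle_x1_x2 :
  phi (x 1) (x 2) = c (phi (x 1) (x 2)) 1 *: x 1 + c (phi (x 1) (x 2)) n *: x n.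
Proof.
apply: bracket_x1_eq0; first exact: ltnW.
have := cocycle_shift_l (x 1) 2 isT.
by rewrite bracket_x1_x1 linear0l scaler0 addr0 => <-.
Qed.

(** Apply the right shift rule to x_n, whose shift is 0: its coefficient must
    vanish, and its other summand does, as phi (x_1, x_n) = 0. *)
Lemma cocycle_coord1_xn_x1 : c (phi (x n) (x 1)) 1 = 0.
Proof.
have := cocycle_shift_r (x 2) n (ltnW n_ge3).
rewrite (bracket_basis_x1 (ltnW n_ge3)) (F1_basis_out (ltnSn n)) linear0r.
move=> /esym/bracket_x2_neq0/eqP.
by rewrite cocycle_x1_basis_eq0 // F1_coord0 addr0 oppr_eq0 => /eqP.
Qed.

Lemma cocycle_basis_basis i j : (2 <= i)%N -> (2 <= j)%N ->
  phi (x i) (x j.+1) =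
  - (c (phi (x j) (x 1)) 1 + c (phi (x 1) (x j)) 1) *: x i.+1.
Proof.
move=> i_ge2 j_ge2.
by rewrite -(bracket_basis_x1 j_ge2) -(bracket_basis_x1 i_ge2) cocycle_shift_r.
Qed.

(** Iterating the left shift rule from phi (x_2, x_2): each step shifts the
    value and adds one more gamma_1 times the new basis vector. *)
Lemma cocycle_basis_x2_shift m :
  phi (x m.+2) (x 2) =
  (m%:R * c (phi (x 1) (x 2)) 1) *: x m.+2
  + \sum_(2 <= k < n.+1) c (phi (x 2) (x 2)) k *: x (k + m).
Proof.
elim: m => [|m IHm].
  rewrite mul0r scale0r add0r [LHS]F1_coord1_eq0_expand; last first.
    exact: cocycle_coord1_basis.
  by apply: eq_bigr => k _; rewrite addn0.
rewrite -[x m.+3]bracket_basis_x1 // cocycle_shift_l // IHm.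
rewrite linearDl linearZl_LR /= linear_sumlz addrAC -scalerDl.
rewrite -[m.+1%:R]natr1 mulrDl mul1r; congr (_ + _).
apply: eq_big_nat => k /andP[k_ge2 _].
rewrite linearZl_LR /= bracket_basis_x1 ?addnS //.
exact: leq_trans (leq_addr _ _).
Qed.

Lemma cocycle_basis_x2 i : (2 <= i <= n)%N ->
  phi (x i) (x 2) =
  ((i - 2)%:R * c (phi (x 1) (x 2)) 1 + c (phi (x 2) (x 2)) 2) *: x i
  + \sum_(3 <= k < (n + 2 - i).+1) c (phi (x 2) (x 2)) k *: x (k + i - 2).
Proof.
case: i => [|[|m]] // /andP[_ lt_mn].
have le_mn : (m <= n)%N := ltnW (ltnW lt_mn).
rewrite cocycle_basis_x2_shift.
rewrite addn2 !subSS subn0 [in LHS]big_ltn ?ltnS ?(ltnW n_ge3) // addrA.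
rewrite add2n -scalerDl; congr (_ + _).
(* the terms with k + m > n are zero *)
rewrite (big_cat_nat (n := (n - m).+1)) /=; last 2 first.
- by rewrite ltnS leq_subRL ?addn2.
- by rewrite ltnS leq_subr.
rewrite [X in _ + X]big_nat [X in _ + X]big1 => [|k /andP[lt_k _]]; last first.
  have lt_nkm : (n < k + m)%N by rewrite addnC -ltn_subLR.
  by rewrite (F1_basis_out lt_nkm) scaler0.
by rewrite addr0; apply: eq_bigr => k _; rewrite !addnS !subSS subn0.
Qed.

End Cocycle.

(** * The classification *)

Theorem proposition3p1 (R : realType) (n : nat) (hn : (3 <= n)%N)
    (phi : {bilinear (F1 R[i] n) -> (F1 R[i] n) -> (F1 R[i] n)})
    (hphi : ZL2 phi) :
  let x := F1_basis R[i] n in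
  exists (alpha : nat -> nat -> R[i]) (gamma1 gamman : R[i])
         (beta : nat -> R[i]),
    phi (x 1%N) (x 1%N) = \sum_(2 <= k < n.+1) alpha 1%N k *: x k
    /\ (forall j : nat, (2 <= j <= n - 1)%N ->
          phi (x j) (x 1%N) = \sum_(1 <= k < n.+1) alpha j k *: x k)
    /\ phi (x n) (x 1%N) = \sum_(2 <= k < n.+1) alpha n k *: x k
    /\ phi (x 1%N) (x 2%N) = gamma1 *: x 1%N + gamman *: x n
    /\ (forall i : nat, (2 <= i <= n)%N ->
          phi (x i) (x 2%N) =
            ((i - 2)%:R * gamma1 + beta 2%N) *: x i
            + \sum_(3 <= k < (n + 2 - i).+1) beta k *: x (k + i - 2)%N)
    /\ (forall i : nat, (2 <= i <= n - 1)%N ->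
          phi (x i) (x 3%N) = - (alpha 2%N 1%N + gamma1) *: x i.+1)
    /\ (forall i j : nat, (2 <= i <= n - 1)%N -> (3 <= j <= n - 1)%N ->
          phi (x i) (x j.+1) = - alpha j 1%N *: x i.+1)
    /\ (forall p q : nat, (1 <= p <= n)%N -> (1 <= q <= n)%N ->
          ~~ [|| q == 1%N,
                 q == 2%N,
                 (q == 3%N) && (2 <= p <= n - 1)%N
               | (4 <= q <= n)%N && (2 <= p <= n - 1)%N] ->
          phi (x p) (x q) = 0).
Proof.
move=> x; have n_ge2 := ltnW hn.
exists (fun j k => F1_coord (phi (x j) (x 1%N)) k).
exists (F1_coord (phi (x 1%N) (x 2%N)) 1), (F1_coord (phi (x 1%N) (x 2%N)) n).
exists (F1_coord (phi (x 2%N) (x 2%N))).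
split; first exact: F1_coord1_eq0_expand (cocycle_coord1_x1_x1 phi hn hphi).
split; first by move=> j _; apply: F1_coord_expand.
split; first exact: F1_coord1_eq0_expand (cocycle_coord1_xn_x1 phi hn hphi).
split; first exact: cocycle_x1_x2.
split; first by move=> i i_int; apply: cocycle_basis_x2.
split; first by move=> i /andP[i_ge2 _]; apply: cocycle_basis_basis.
split=> [i j /andP[i_ge2 _] /andP[j_ge3 _] | p q /andP[p_ge1 le_pn]].
  rewrite [LHS]cocycle_basis_basis ?(ltnW j_ge3) //.
  by rewrite cocycle_x1_basis_eq0 // F1_coord0 addr0.
case: q => // -[|[|q]] // /andP[_ le_qn] q_unlisted.
(* q >= 3 is listed exactly for the middle values of p *)
have {q_unlisted}: ~~ (2 <= p <= n - 1)%N.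
  apply: contra q_unlisted => ->; rewrite /= !andbT.
  by case: q le_qn => //= q ->.
case: (ltngtP p 1%N) p_ge1 => // [p_ge2 _ | -> _ _]; last first.
  by rewrite cocycle_x1_basis_eq0.
rewrite /= -ltnNge subn1 prednK ?(ltnW n_ge2) // => le_np.
by rewrite [LHS]cocycle_basis_basis // (F1_basis_out (k := p.+1)) ?scaler0.
Qed.
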